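(* Let $(A,\circ)$ be a mock-Lie algebra, let $(V,\pi)$ be a representation of $(A,\circ)$, and let $\mathcal{K}:V\to A$ be an embedding tensor on $(A,\circ)$ with respect to $(V,\pi)$. Then $(V,\{\cdot,\cdot\}_{\mathcal{K}})$ is an anti-Leibniz algebra, where $$\{u,v\}_{\mathcal{K}}=\pi(\mathcal{K}(u))(v),\qquad \forall u,v\in V.$$
   Context: All vector spaces and algebras are finite dimensional over a field $\mathbb{K}$ of characteristic zero. A mock-Lie algebra $(A,\circ)$ is a vector space $A$ with a commutative bilinear product $\circ$ satisfying $x\circ(y\circ z)+y\circ(z\circ x)+z\circ(x\circ y)=0$ for all $x,y,z\in A$. A representation of $(A,\circ)$ on a vector space $V$ is a linear map $\pi:A\to \mathrm{End}(V)$ with $\pi(x\circ y)=-\pi(x)\pi(y)-\pi(y)\pi(x)$ for all $x,y\in A$. An embedding tensor on $(A,\circ)$ with respect to $(V,\pi)$ is a linear map $\mathcal{K}:V\to A$ with $\mathcal{K}(u)\circ\mathcal{K}(v)=\mathcal{K}(\pi(\mathcal{K}(u))v)$ for all $u,v\in V$. An anti-Leibniz algebra $(L,\{\cdot,\cdot\})$ is a vector space $L$ with a bilinear bracket satisfying $\{x,\{y,z\}\}=-\{\{x,y\},z\}-\{y,\{x,z\}\}$ for all $x,y,z\in L$. *)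

(* Defs.v *)
From mathcomp Require Import all_boot all_order all_algebra.
Set Implicit Arguments.
Unset Strict Implicit.
Unset Printing Implicit Defensive.
Import GRing.Theory.
Local Open Scope ring_scope.

Record mock_Lie_algebra (F : fieldType) (A : vectType F)
    (op : A -> A -> A) : Prop := MockLieAlgebra {
  mock_Lie_bilinear : bilinear_for *:%R *:%R op;
  mock_Lie_comm : forall x y, op x y = op y x;
  mock_Lie_jacobi : forall x y z,
    op x (op y z) + op y (op z x) + op z (op x y) = 0
}.

Definition mock_Lie_representation (F : fieldType) (A V : vectType F)
    (op : A -> A -> A) (pi : {linear A -> 'End(V)}) : Prop :=
  forall x y, pi (op x y) = - (pi x \o pi y)%VF - (pi y \o pi x)%VF.

Definition embedding_tensor (F : fieldType) (A V : vectType F)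
    (op : A -> A -> A) (pi : {linear A -> 'End(V)})
    (K : {linear V -> A}) : Prop :=
  forall u v, op (K u) (K v) = K (pi (K u) v).

Record anti_Leibniz_algebra (F : fieldType) (L : vectType F)
    (br : L -> L -> L) : Prop := AntiLeibnizAlgebra {
  anti_Leibniz_bilinear : bilinear_for *:%R *:%R br;
  anti_Leibniz_identity : forall x y z,
    br x (br y z) = - br (br x y) z - br y (br x z)
}.

Definition descendent_bracket (F : fieldType) (A V : vectType F)
    (pi : {linear A -> 'End(V)}) (K : {linear V -> A}) (u v : V) : V :=
  pi (K u) v.

(* Main.v *)
Require Import Defs.
From mathcomp Require Import all_boot all_order all_algebra.
Set Implicit Arguments.
Unset Strict Implicit.
Unset Printing Implicit Defensive.
Import GRing.Theory.
Local Open Scope ring_scope.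

(** The bracket [{u, v} = pi (K u) v] is bilinear because [pi], [K] and every
    value of [pi] are linear. The embedding tensor condition turns the nested
    bracket [{{u, v}, w} = pi (K (pi (K u) v)) w] into
    [pi (op (K u) (K v)) w], and the representation identity expands this as
    [- {u, {v, w}} - {v, {u, w}}]; solving for [{u, {v, w}}] gives the
    anti-Leibniz identity. *)

Theorem theorem3p6 (F : fieldType) (char0 : [pchar F] =i pred0)
    (A V : vectType F) (op : A -> A -> A) (pi : {linear A -> 'End(V)})
    (K : {linear V -> A})
    (hA : mock_Lie_algebra op)
    (hpi : mock_Lie_representation op pi)
    (hK : embedding_tensor op pi K) :
  anti_Leibniz_algebra (descendent_bracket pi K).
Proof.
split; last first.
  move=> u v w; rewrite /descendent_bracket -hK hpi.
  by rewrite !lfunE /= !lfunE /= !lfunE /= opprD !opprK addrK.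
split=> [w|u] a x y; rewrite /descendent_bracket /=.
  by rewrite !linearP /= add_lfunE scale_lfunE.
by rewrite linearP.
Qed.
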